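(* For $m,n,s,t=0,1,2,\dots$ and $\beta>-1$, $$\int_{\mathbb R^2}Z^{(\beta)}_{m,n}(z,\bar z)\,\overline{Z^{(\beta)}_{s,t}(z,\bar z)}\,(z\bar z)^\beta e^{-z\bar z}\,r\,dr\,d\theta=\pi\,\frac{\Gamma(\beta+m\vee n+1)}{(m\wedge n)!}\,\delta_{m,s}\,\delta_{n,t},$$ where $z=re^{i\theta}$.
   Context: For $\beta>-1$ and integers $m\ge n\ge0$, $$Z^{(\beta)}_{m,n}(z_1,z_2)=\frac1{n!}\sum_{k=0}^n\binom nk\frac{(\beta+1)_m}{(\beta+1)_{m-k}}(-1)^{n-k}z_1^{m-k}z_2^{n-k},$$ and $Z^{(\beta)}_{m,n}(z_1,z_2)=Z^{(\beta)}_{n,m}(z_2,z_1)$ for $m<n$. Here $(a)_k=a(a+1)\cdots(a+k-1)$, $m\vee n=\max\{m,n\}$, $m\wedge n=\min\{m,n\}$. *)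

(* Defs.v *)
From HB Require Import structures.
From mathcomp Require Import all_boot all_order all_algebra.
From mathcomp Require Import all_classical all_reals all_analysis.
From mathcomp Require Import complex.

Set Implicit Arguments.
Unset Strict Implicit.
Unset Printing Implicit Defensive.

Import Order.TTheory GRing.Theory Num.Theory.
Import numFieldNormedType.Exports.

Local Open Scope classical_set_scope.
Local Open Scope ring_scope.
Local Open Scope complex_scope.

(* (a)_k = a (a + 1) ... (a + k - 1) *)
Definition pochhammer (R : realType) (a : R) (k : nat) : R :=
  \prod_(i < k) (a + i%:R).

(* Euler's integral, meaningful for a > 0 (for other a the Lebesgue integral is
   +oo and Rintegral returns the default value 0). *)
Definition Gamma (R : realType) (a : R) : R :=
  \int[@lebesgue_measure R]_(t in `]0, +oo[) (t `^ (a - 1) * expR (- t)).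

(* Defining formula of Z^(beta)_{m,n}, used for n <= m only. *)
Definition Zge (R : realType) (beta : R) (m n : nat) (z1 z2 : R[i]) : R[i] :=
  (n`!)%:R^-1 *
  \sum_(k < n.+1)
     'C(n, k)%:R
     * (pochhammer (beta + 1) m / pochhammer (beta + 1) (m - k))%:C
     * (-1) ^+ (n - k) * z1 ^+ (m - k) * z2 ^+ (n - k).

Definition Zpoly (R : realType) (beta : R) (m n : nat) (z1 z2 : R[i]) : R[i] :=
  if (n <= m)%N then Zge beta m n z1 z2 else Zge beta n m z2 z1.

(* The library has no integral of complex-valued functions: it is taken
   componentwise. *)
Definition cintegrable d (T : measurableType d) (R : realType)
    (mu : {measure set T -> \bar R}) (D : set T) (f : T -> R[i]) : Prop :=
  mu.-integrable D (fun x => (complex.Re (f x))%:E) /\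
  mu.-integrable D (fun x => (complex.Im (f x))%:E).

Definition cintegral d (T : measurableType d) (R : realType)
    (mu : {measure set T -> \bar R}) (D : set T) (f : T -> R[i]) : R[i] :=
  (\int[mu]_(x in D) complex.Re (f x)) +i* (\int[mu]_(x in D) complex.Im (f x)).

(* r e^{i theta} *)
Definition polar (R : realType) (r theta : R) : R[i] :=
  r%:C * (cos theta +i* sin theta).

(* The pairs (r, theta) parametrizing the plane minus the origin. *)
Definition polar_domain (R : realType) : set (R * R) :=
  `]0, +oo[%classic `*` `[0, 2 * pi[%classic.

(* dr dtheta *)
Definition drdtheta (R : realType) :
    {measure set (measurableTypeR R * measurableTypeR R) -> \bar R} :=
  (@lebesgue_measure R \x @lebesgue_measure R)%E.

(* z * conjc z is a nonnegative real; its real power and exponential are taken in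
   R. *)
Definition Zweight (R : realType) (beta : R) (z : R[i]) : R :=
  complex.Re (z * conjc z) `^ beta * expR (- complex.Re (z * conjc z)).

Definition Zintegrand (R : realType) (beta : R) (m n s t : nat) (z : R[i])
    : R[i] :=
  Zpoly beta m n z (conjc z) * conjc (Zpoly beta s t z (conjc z)) * (Zweight beta z)%:C.

(* Main.v *)
Require Import Defs.
From HB Require Import structures.
From mathcomp Require Import all_boot all_order all_algebra.
From mathcomp Require Import all_classical all_reals all_analysis.
From mathcomp Require Import complex.
From mathcomp Require Import measurable_realfun zify ring lra.

Set Implicit Arguments.
Unset Strict Implicit.
Unset Printing Implicit Defensive.

Import Order.TTheory GRing.Theory Num.Theory.
Import numFieldNormedType.Exports.

Local Open Scope classical_set_scope.
Local Open Scope ring_scope.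
Local Open Scope complex_scope.

(** In polar coordinates both polynomials separate.  With d = |m - n| and
p = min(m, n), the polynomial Z_{m,n} at (z, conj z), z = r e^{i x}, is

   r^d L(r^2) e^{i (m - n) x},   L = L_p^{(beta + d)},

a generalized Laguerre polynomial in r^2 times a power of r and a pure phase
[Zpoly_polar].  So the integrand is a real function of r times e^{i k x} with
the integer k = (m - n) - (s - t) [Zintegrand_polar].  By Fubini
[integral_polar_tensor] the integral is the product of a radial and an angular
integral, and the latter is 2 pi if k = 0 and 0 otherwise [Rintegral_cos_int],
[Rintegral_sin_int].

If k = 0, then |s - t| = d as well; put q = min(s, t).  The substitution
u = r^2 [integral_radial_density] turns the radial integral into half of
the integral of u^(beta + d) e^(-u) L_p(u) L_q(u).  Monomials integrate to
values of Gamma, so this is half the value at L_p * L_q of the linear form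
u^j |-> Gamma (beta + d + j + 1) [gamma_moment].  By the recursion
Gamma (a + 1) = a Gamma a [Gamma_rec], the value of this form at u^j L_p is,
up to a constant, a p-th finite difference of a rising factorial, which is a
polynomial of degree j [alternating_bin_pochhammer]: it vanishes for j < p and
is determined by the leading coefficient for j = p.  This is the orthogonality
of the Laguerre polynomials [gamma_moment_laguerre].

Integrability comes with the same computations.  The measure-theoretic core
is that the integral defining Gamma is finite for a > 0
[integral_gamma_density_lty]; that integral and its recursion are handled in
the extended reals, as monotone limits of integrals over compact intervals
exhausting ]0, +oo[. *)

Local Notation halfline R := (`]0%R, +oo[%classic : set R).

(** * Integrals over the half-line as limits over compact intervals *)

Section HalfLine.
Context {R : realType}.
Implicit Types (x : R) (h : R -> R).
Local Notation mu := (@lebesgue_measure R).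

(** The bounds l and u are arbitrary because a change of variables exhausts its
two sides with different intervals, [l n, u n] and their images. *)
Lemma cvg_integral_halfline h (l u : R^nat) :
  nonincreasing_seq l -> nondecreasing_seq u ->
  (forall n, 0 < l n) -> l @ \oo --> 0 -> u @ \oo --> +oo ->
  measurable_fun (halfline R) h -> (forall x, 0 < x -> 0 <= h x) ->
  (\int[mu]_(x in `[l n, u n]) (h x)%:E)%E @[n --> \oo] -->
  (\int[mu]_(x in halfline R) (h x)%:E)%E.
Proof.
move=> nil ndu l0 cl cu mh h0.
have sub n : `[l n, u n] `<=` halfline R.
  by move=> x /=; rewrite !in_itv/= andbT => /andP[+ _]; exact: lt_le_trans.
suff -> : halfline R = \bigcup_n `[l n, u n]%classic.
  apply: ge0_nondecreasing_set_cvg_integral => //=.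
  - move=> i j ij; apply/subsetPset => x /=; rewrite !in_itv/= => /andP[lx xu].
    by rewrite (le_trans (nil _ _ ij) lx) (le_trans xu (ndu _ _ ij)).
  - move=> i; apply/measurable_EFinP.
    exact: measurable_funS mh.
  - move=> i x /sub; rewrite /= in_itv/= andbT lee_fin; exact: h0.
rewrite eqEsubset; split => [x /=|x [n _ /sub//]].
rewrite in_itv/= andbT => x0.
have lx : \forall n \near \oo, l n <= x.
  by apply: (cvgr_le 0 cl).
have ux : \forall n \near \oo, x <= u n by move/cvgryPge : cu; exact.
have [n [lnx unx]] : exists n, l n <= x /\ x <= u n.
  near \oo => n; exists n; split; [near: n; exact: lx|near: n; exact: ux].
by exists n => //=; rewrite in_itv/= lnx unx.
Unshelve. all: end_near. Qed.

End HalfLine.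

(** * The Gamma function *)

Section GammaDensity.
Context {R : realType}.
Implicit Types a t : R.
Local Notation mu := (@lebesgue_measure R).

Definition gamma_density a t : R := t `^ (a - 1) * expR (- t).

Lemma gamma_density_ge0 a t : 0 <= gamma_density a t.
Proof. by rewrite mulr_ge0 ?powR_ge0 ?expR_ge0. Qed.

Lemma continuous_powR a t : 0 < t -> {for t, continuous (fun x : R => x `^ a)}.
Proof.
move=> t0; have [+ _] := is_derive1_powR a t0.
by move/derivable1_diffP/differentiable_continuous.
Qed.

Lemma continuous_expRN : continuous (fun x : R => expR (- x)).
Proof.
move=> t; apply: continuous_comp; first exact: opp_continuous.
exact: continuous_expR.
Qed.

Lemma continuous_gamma_density a t :
  0 < t -> {for t, continuous (gamma_density a)}.
Proof.
move=> t0; apply: continuousM; first exact: continuous_powR.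
exact: continuous_expRN.
Qed.

Lemma measurable_gamma_density a (D : set R) :
  measurable D -> measurable_fun D (gamma_density a).
Proof.
move=> mD; apply: measurable_funTS; apply: measurable_funM.
  exact: measurable_powR.
by apply: measurableT_comp => //; exact: measurable_expR.
Qed.

(** For an integer N >= a and t >= 1, t^a <= t^N, while the exponential series
gives t^(N+1) / (N+1)! <= exp t. *)
Lemma cvg_powR_expRN a : t `^ a * expR (- t) @[t --> +oo] --> (0 : R).
Proof.
have [N aN] : exists N, a <= N%:R.
  exists (Num.truncn `|a|).+1.
  exact: le_trans (ler_norm _) (ltW (truncnS_gt _)).
apply/cvgrPdist_le => e e0; near=> t.
have t1 : 1 <= t by near: t; apply: nbhs_pinfty_ge; exact: num_real.
have t0 : 0 < t by apply: lt_le_trans t1.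
rewrite sub0r normrN ger0_norm ?mulr_ge0 ?powR_ge0 ?expR_ge0//.
(* t is large enough for the remaining factor t / (N+1)! to exceed 1 / e. *)
have teN : (N.+1`!)%:R / e <= t.
  by near: t; apply: nbhs_pinfty_ge; exact: num_real.
rewrite expRN ler_pdivrMr ?expR_gt0//.
apply: (@le_trans _ _ (t ^+ N)); first by rewrite -powR_mulrn ?(ltW t0)// ler_powR.
have := expR_ge1Dxn N (ltW t0) => E.
apply: (@le_trans _ _ (e * (t ^+ N.+1 / (N.+1`!)%:R))); last first.
  by rewrite ler_pM2l//; apply: le_trans E; rewrite lerDr.
have F0 : 0 < (N.+1`!)%:R :> R by rewrite ltr0n fact_gt0.
rewrite mulrA ler_pdivlMr// exprS mulrA mulrC ler_pM2r ?exprn_gt0//.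
by rewrite mulrC -ler_pdivrMr.
Unshelve. all: end_near. Qed.

Local Notation l := (fun n : nat => (n.+1%:R : R)^-1).
Local Notation u := (fun n : nat => (n.+1%:R : R)).
Lemma cvg_succ_pinfty : (n.+1%:R : R) @[n --> \oo] --> +oo.
Proof.
apply/cvgryPge => A; near=> n; apply: (le_trans (ltW (truncnS_gt A))).
by rewrite ler_nat ltnS; near: n; exact: nbhs_infty_ge.
Unshelve. all: end_near. Qed.

Lemma within_continuous_itv_gt0 (h : R -> R) x y : 0 < x ->
  (forall t, 0 < t -> {for t, continuous h}) -> {within `[x, y], continuous h}.
Proof.
move=> x0 ch; apply: continuous_in_subspaceT => t.
rewrite inE/= in_itv/= => /andP[xt _].
by apply: ch; apply: lt_le_trans xt.
Qed.

Lemma derivable_oo_LR_gt0 (F : R -> R) x y : 0 < x -> x < y ->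
  (forall t, 0 < t -> derivable F t 1) -> derivable_oo_LRcontinuous F x y.
Proof.
move=> x0 xy dF; have cF t : 0 < t -> {for t, continuous F}.
  by move=> /dF /derivable1_diffP/differentiable_continuous.
split.
- by move=> t; rewrite in_itv/= => /andP[xt _]; apply: dF; exact: lt_trans xt.
- by apply: cvg_at_right_filter; exact: cF.
- by apply: cvg_at_left_filter; apply: cF; exact: lt_trans xy.
Qed.

Lemma is_derive_NexpRN t : is_derive t 1 (fun x : R => - expR (- x)) (expR (- t)).
Proof.
apply: is_derive_eq.
by rewrite mulrN1 opprK.
Qed.

(** On a compact interval away from 0 everything is smooth, whatever the sign
of a; the recursion is the limit of this identity. *)
Lemma integral_gamma_density_by_parts a x y : 0 < x -> x < y ->
  (\int[mu]_(t in `[x, y]) (gamma_density (a + 1) t)%:E =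
   (x `^ a * expR (- x) - y `^ a * expR (- y))%:E
   + a%:E * \int[mu]_(t in `[x, y]) (gamma_density a t)%:E)%E.
Proof.
move=> x0 xy.
under eq_integral do rewrite /gamma_density addrK.
rewrite (@integration_by_parts _ _ (fun x : R => - expR (- x))
  (fun t => a * t `^ (a - 1)) _ _ _ xy); last 6 first.
- apply: within_continuous_itv_gt0 => // t t0; apply: continuousM.
  + exact: cst_continuous.
  + exact: continuous_powR.
- apply: derivable_oo_LR_gt0 => // t t0.
  by apply: derivable_powR; rewrite in_itv/= t0.
- move=> t; rewrite in_itv/= => /andP[xt _]; apply: powR_derive1.
  by rewrite in_itv/= andbT (lt_trans x0).
- by apply: within_continuous_itv_gt0 => // t t0; exact: continuous_expRN.
- by apply: derivable_oo_LR_gt0 => // t t0; have [] := is_derive_NexpRN t.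
- by move=> t _; rewrite derive1E; have [_ ->] := is_derive_NexpRN t.
congr (_ + _)%E; first by congr EFin; ring.
rewrite -integralZl//; last first.
  apply: continuous_compact_integrable; first exact: segment_compact.
  by apply: within_continuous_itv_gt0 => // t t0; exact: continuous_gamma_density.
rewrite -integralN/=; last first.
  apply: integrable_add_def; first by [].
  apply: continuous_compact_integrable; first exact: segment_compact.
  apply: within_continuous_itv_gt0 => // t t0; apply: continuousM.
    by apply: continuousM; [exact: cst_continuous|exact: continuous_powR].
  by apply: continuousN; exact: continuous_expRN.
apply: eq_integral => t _.
by rewrite -EFinM; congr EFin; rewrite /gamma_density; ring.
Qed.

Lemma cvg_integral_gamma_density a :
  (\int[mu]_(t in `[l n, u n]) (gamma_density a t)%:E)%E @[n --> \oo] -->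
  (\int[mu]_(t in halfline R) (gamma_density a t)%:E)%E.
Proof.
apply: cvg_integral_halfline.
- by move=> i j ij; rewrite lef_pV2 ?posrE ?ler_nat.
- by move=> i j ij; rewrite ler_nat.
- by move=> n; rewrite invr_gt0.
- exact: cvg_harmonic.
- exact: cvg_succ_pinfty.
- exact: measurable_gamma_density.
- by move=> t _; exact: gamma_density_ge0.
Qed.

(** Stated in the extended reals, so that it can be used to prove finiteness:
for a > 0 the boundary terms vanish at both ends. *)
Lemma integral_gamma_density_rec a : 0 < a ->
  (\int[mu]_(t in halfline R) (gamma_density (a + 1) t)%:E =
  a%:E * \int[mu]_(t in halfline R) (gamma_density a t)%:E)%E.
Proof.
move=> a0.
have C1 := @cvg_integral_gamma_density (a + 1).
have C2 : (a%:E * \int[mu]_(t in `[l n, u n]) (gamma_density a t)%:E)%E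
    @[n --> \oo] -->
  (a%:E * \int[mu]_(t in halfline R) (gamma_density a t)%:E)%E.
  by apply: cvgeZl => //; exact: cvg_integral_gamma_density.
have B0 : ((l n) `^ a * expR (- l n) - (u n) `^ a * expR (- u n))
    @[n --> \oo] --> (0 : R).
  rewrite -[X in _ --> X]subr0; apply: cvgB; last first.
    exact: (cvg_comp _ _ cvg_succ_pinfty (@cvg_powR_expRN a)).
  rewrite -(mul0r (expR (- 0))); apply: cvgM; last first.
    apply: (@cvg_comp _ _ _ l (fun x => expR (- x)) _ (nbhs 0)).
      exact: cvg_harmonic.
    exact: continuous_expRN.
  apply: (@cvg_comp _ _ _ l (fun x => x `^ a) _ (0^'+)); last exact: powR_cvg0.
  move=> A /= hA; have H : nbhs \oo ((fun t : R => 0 < t -> A t) \o l).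
    exact: (@cvg_harmonic R _ hA).
  by apply: filterS H => n; apply; rewrite /= invr_gt0.
have B1 : ((l n) `^ a * expR (- l n) - (u n) `^ a * expR (- u n))%:E
    @[n --> \oo] --> (0 : R)%:E.
  by apply/cvg_EFin; [exact: nearW => n|exact: B0].
have /= := @cvgeD _ _ _ _ _ _ _ _ _ B1 C2.
rewrite add0e => H; have {H} C3 := H (@eventually_filter) isT.
apply: (cvg_unique _ C1) => //.
move: C3; apply: cvg_trans.
apply: near_eq_cvg.
exists 1%N => // n /= n1.
apply/esym/integral_gamma_density_by_parts; first by rewrite invr_gt0.
apply: (@lt_trans _ _ 1); last by rewrite ltr1n.
by rewrite invf_lt1 ?ltr1n.
Qed.
(** The total mass of the exponential distribution of rate 1. *)
Lemma integral_gamma_density1 :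
  (\int[mu]_(t in halfline R) (gamma_density 1 t)%:E = 1)%E.
Proof.
rewrite integral_itv_obnd_cbnd; last first.
  by apply/measurable_EFinP; exact: measurable_gamma_density.
rewrite -[RHS](@integral_exponential_pdf R 1)// integral_mkcond.
apply: eq_integral => t _; rewrite /exponential_pdf !patchE.
case: ifPn => // _.
by rewrite /gamma_density subrr powRr0 !mul1r mulN1r.
Qed.

Lemma gamma_density_nat_finite (N : nat) :
  (\int[mu]_(t in halfline R) (gamma_density N.+1%:R t)%:E < +oo)%E.
Proof.
elim: N => [|N IH]; first by rewrite integral_gamma_density1 ltry.
rewrite -natr1 integral_gamma_density_rec//.
by rewrite lte_mul_pinfty// lee_fin.
Qed.

(** The singularity of t^(a-1) at 0 is removed by the recursion: it is enough to
bound the integral at a + 1, and t^a <= 1 + t^N for any integer N >= a, where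
both terms have finite integrals by induction on integers. *)
Lemma integral_gamma_density_lty a : 0 < a ->
  (\int[mu]_(t in halfline R) (gamma_density a t)%:E < +oo)%E.
Proof.
move=> a0.
pose N := Num.truncn a.
have aN : a <= N.+1%:R by exact: ltW (truncnS_gt _).
suff H : (\int[mu]_(t in halfline R) (gamma_density (a + 1) t)%:E < +oo)%E.
  move: H; rewrite integral_gamma_density_rec//.
  have : (0 <= \int[mu]_(t in halfline R) (gamma_density a t)%:E)%E.
    by apply: integral_ge0 => t _; rewrite lee_fin gamma_density_ge0.
  (* a finite multiple a * I with a > 0 excludes I = +oo *)
  case: (integral _ _ _) => [r _ _|_|]; rewrite ?ltry//.
  by rewrite gt0_muley// ltxx.
have mg b : measurable_fun (halfline R) (fun t : R => (gamma_density b t)%:E).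
  by apply/measurable_EFinP; exact: measurable_gamma_density.
apply: (@le_lt_trans _ _ (\int[mu]_(t in halfline R)
    ((gamma_density 1 t)%:E + (gamma_density N.+2%:R t)%:E))%E).
  apply: ge0_le_integral => //.
  - by move=> t _; rewrite lee_fin gamma_density_ge0.
  - exact: mg.
  - by apply: emeasurable_funD; exact: mg.
  - move=> t; rewrite /= in_itv/= andbT => t0.
    rewrite -EFinD lee_fin /gamma_density -mulrDl ler_wpM2r ?expR_ge0//.
    rewrite addrK subrr powRr0 -natr1 addrK.
    have [t1|t1] := leP t 1.
      rewrite -[leLHS]addr0 lerD ?powR_ge0//.
      apply: (@le_trans _ _ (t `^ 0)); last by rewrite powRr0.
      by apply: ger_powR; rewrite ?t0// ltW.
    by rewrite -[leLHS]add0r lerD//; apply: ler_powR => //; exact: ltW.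
have g0 b (t : R) : halfline R t -> (0 <= (gamma_density b t)%:E)%E.
  by move=> _; rewrite lee_fin gamma_density_ge0.
rewrite ge0_integralD //; [|exact: g0|exact: mg|exact: g0|exact: mg].
rewrite lte_add_pinfty//; first exact: (gamma_density_nat_finite 0).
exact: gamma_density_nat_finite.
Qed.

Lemma gamma_densityE a : 0 < a ->
  (\int[mu]_(t in halfline R) (gamma_density a t)%:E = (Gamma a)%:E)%E.
Proof.
move=> a0; rewrite /Gamma /Rintegral fineK//.
rewrite ge0_fin_numE ?integral_gamma_density_lty//.
by apply: integral_ge0 => t _; rewrite lee_fin gamma_density_ge0.
Qed.

Lemma Gamma_rec a : 0 < a -> Gamma (a + 1) = a * Gamma a.
Proof.
move=> a0; apply: EFin_inj; rewrite EFinM -!gamma_densityE ?addr_gt0//.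
exact: integral_gamma_density_rec.
Qed.

(** * The substitution t = r^2 *)

Definition radial_density a (r : R) : R :=
  (r ^+ 2) `^ (a - 1) * expR (- r ^+ 2) * r.

Lemma measurable_radial_density a (D : set R) :
  measurable D -> measurable_fun D (radial_density a).
Proof.
move=> mD; apply: measurable_funTS; apply: measurable_funM => //.
apply: (measurableT_comp (measurable_gamma_density a measurableT)).
exact: measurable_funX.
Qed.

Lemma radial_density_ge0 a r : 0 < r -> 0 <= radial_density a r.
Proof. by move=> r0; rewrite !mulr_ge0 ?powR_ge0 ?expR_ge0 ?ltW. Qed.

Lemma derive_sqr : (fun x : R => x ^+ 2)^`()%classic = (fun x => 2 * x).
Proof.
apply/funext => x; rewrite derive1E exp_derive expr1 scaler_nat mulr_natl.
by rewrite /GRing.scale/= mulr1.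
Qed.

Lemma integral_radial_density_itv a (x y : R) : 0 < x -> x < y ->
  (\int[mu]_(t in `[(x ^+ 2)%R, (y ^+ 2)%R]) (gamma_density a t)%:E =
   \int[mu]_(r in `[x, y]) (2 * radial_density a r)%:E)%E.
Proof.
move=> x0 xy.
have c2 : continuous (fun z : R => 2 * z) by move=> z; exact: mulrl_continuous.
rewrite (@integration_by_substitution_increasing _ (fun x => x ^+ 2)) ?(ltW xy)//.
- apply: eq_integral => r _; rewrite derive_sqr fctE /=.
  by rewrite /radial_density /gamma_density; congr EFin; ring.
- move=> r s; rewrite !in_itv/= => /andP[xr _] /andP[xs _] rs.
  by rewrite ltr_pXn2r// nnegrE ltW// (lt_le_trans x0).
- by rewrite derive_sqr => r _; exact: c2.
- by rewrite derive_sqr; exact: (cvgP _ (cvg_at_right_filter (c2 x))).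
- by rewrite derive_sqr; exact: (cvgP _ (cvg_at_left_filter (c2 y))).
- by apply: derivable_oo_LR_gt0 => // t t0; exact: exprn_derivable.
- apply: within_continuous_itv_gt0; first exact: exprn_gt0.
  exact: continuous_gamma_density.
Qed.

(** Both sides are exhausted by compact intervals, [1/n^2, n^2] for t and
[1/n, n] for r, since the derivative 2 r of the substitution is unbounded
on the half-line and t^(a-1) may be singular at 0. *)
Lemma integral_radial_density a : 0 < a ->
  (\int[mu]_(r in halfline R) (radial_density a r)%:E = (Gamma a / 2)%:E)%E.
Proof.
move=> a0.
have nl : nonincreasing_seq l by move=> i j ij; rewrite lef_pV2 ?posrE ?ler_nat.
have nu : nondecreasing_seq u by move=> i j ij; rewrite ler_nat.
have l0 n : 0 < l n by rewrite invr_gt0.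
have C1 : (\int[mu]_(t in `[(l n ^+ 2)%R, (u n ^+ 2)%R])
    (gamma_density a t)%:E)%E @[n --> \oo] -->
  (\int[mu]_(t in halfline R) (gamma_density a t)%:E)%E.
  apply: cvg_integral_halfline.
  - by move=> i j ij; rewrite ler_pXn2r ?nnegrE ?invr_ge0//; exact: nl.
  - by move=> i j ij; rewrite ler_pXn2r ?nnegrE//; exact: nu.
  - by move=> n; rewrite exprn_gt0.
  - have := @exprn_continuous R 2 0; rewrite /continuous_at expr0n /=.
    exact: (cvg_comp _ _ (@cvg_harmonic R)).
  - apply/cvgryPge => A; near=> n.
    apply: (@le_trans _ _ n.+1%:R); last by rewrite expr2 ler_peMr// ler1n.
    by near: n; move/cvgryPge : cvg_succ_pinfty; exact.
  - exact: measurable_gamma_density.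
  - by move=> t _; exact: gamma_density_ge0.
have C2 : (\int[mu]_(r in `[l n, u n]) (2 * radial_density a r)%:E)%E
    @[n --> \oo] -->
  (\int[mu]_(t in halfline R) (2 * radial_density a t)%:E)%E.
  apply: cvg_integral_halfline => //.
  - exact: cvg_harmonic.
  - exact: cvg_succ_pinfty.
  - by apply: measurable_funM => //; exact: measurable_radial_density.
  - by move=> t t0; rewrite mulr_ge0 ?radial_density_ge0.
have E : (\int[mu]_(t in halfline R) (gamma_density a t)%:E =
   \int[mu]_(r in halfline R) (2 * radial_density a r)%:E)%E.
  apply: (cvg_unique _ C1) => //.
  apply: cvg_trans C2; apply: near_eq_cvg.
  exists 1%N => // n /= n1.
  apply/esym/integral_radial_density_itv; first by rewrite invr_gt0.
  by apply: (@lt_trans _ _ 1); rewrite ?ltr1n// invf_lt1 ?ltr1n.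
move: E; under [X in _ = X]eq_integral do rewrite EFinM.
rewrite ge0_integralZl//; last 2 first.
- by apply/measurable_EFinP; exact: measurable_radial_density.
- move=> t; rewrite /= in_itv/= andbT => t0.
  by rewrite lee_fin radial_density_ge0.
rewrite gamma_densityE// => E.
by rewrite mulrC EFinM E muleA -EFinM mulVf ?pnatr_eq0// mul1e.
Unshelve. all: end_near. Qed.

Lemma integrable_radial_density a : 0 < a ->
  mu.-integrable (halfline R) (EFin \o radial_density a).
Proof.
move=> a0; apply/integrableP; split.
  by apply/measurable_EFinP; exact: measurable_radial_density.
under eq_integral => t.
  rewrite inE/= in_itv/= andbT => t0.
  rewrite ger0_norm ?radial_density_ge0//.
  over.
by rewrite integral_radial_density// ltry.
Qed.

End GammaDensity.

(** * Polar form of the polynomials *)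

Section Cis.
Context {R : realType}.
Implicit Types (x r : R).

Definition cis x : R[i] := cos x +i* sin x.

Lemma cisD x y : cis (x + y) = cis x * cis y.
Proof.
by rewrite /cis cosD sinD; apply/eqP; rewrite eq_complex/= eqxx/= addrC.
Qed.

Lemma cisX x n : cis x ^+ n = cis (n%:R * x).
Proof.
elim: n => [|n IH]; first by rewrite expr0 mul0r /cis cos0 sin0.
by rewrite exprSr IH -natr1 mulrDl mul1r cisD.
Qed.

Lemma mul_real_cis (a x : R) : a%:C * cis x = (a * cos x) +i* (a * sin x).
Proof.
by rewrite /cis; apply/eqP; rewrite eq_complex/= !mul0r subr0 addr0 !eqxx.
Qed.

Lemma conjc_mul_cis a x : conjc (a%:C * cis x) = a%:C * cis (- x).
Proof. by rewrite !mul_real_cis /= cosN sinN mulrN. Qed.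

Lemma conjc_polar r x : conjc (polar r x) = polar r (- x).
Proof. exact: conjc_mul_cis. Qed.

Lemma polar_mul_conjc r x : polar r x * conjc (polar r x) = (r ^+ 2)%:C.
Proof.
by rewrite conjc_polar /polar mulrACA -cisD subrr /cis cos0 sin0 mulr1 -rmorphM.
Qed.

Lemma polarX r x n : polar r x ^+ n = (r ^+ n)%:C * cis (n%:R * x).
Proof. by rewrite /polar exprMn cisX rmorphXn. Qed.

Lemma Zweight_polar beta r x :
  Zweight beta (polar r x) = (r ^+ 2) `^ beta * expR (- r ^+ 2).
Proof. by rewrite /Zweight polar_mul_conjc. Qed.

End Cis.

Section Laguerre.
Context {R : realType}.
Implicit Types (beta x r : R).

(** The Laguerre polynomial L_n^{(beta + d)}.  The ratio of rising factorials is
Gamma (beta + d + n + 1) / Gamma (beta + d + j + 1). *)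
Definition laguerre beta d n : {poly R} :=
  \poly_(j < n.+1) ((n`!)%:R^-1 * ('C(n, j)%:R
    * (pochhammer (beta + 1) (d + n) / pochhammer (beta + 1) (d + j))
    * (-1) ^+ j)).

(** Since z * conj z = r^2, the monomial z^(d+j) (conj z)^j is z^d r^(2j); the
sum is reindexed by j = n - k. *)
Lemma Zge_polar beta d n r x :
  Zge beta (d + n) n (polar r x) (conjc (polar r x)) =
  (r ^+ d * (laguerre beta d n).[r ^+ 2])%:C * cis (d%:R * x).
Proof.
have zw := polar_mul_conjc r x.
have -> : (r ^+ d * (laguerre beta d n).[r ^+ 2])%:C * cis (d%:R * x) =
  polar r x ^+ d * ((laguerre beta d n).[r ^+ 2])%:C.
  by rewrite polarX rmorphM /=; ring.
move: (polar r x) (conjc (polar r x)) zw => z w zw.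
rewrite /Zge (reindex_inj rev_ord_inj) /= horner_poly rmorph_sum /= !mulr_sumr.
apply: eq_bigr => j _.
have jn : (j <= n)%N by rewrite -ltnS.
rewrite subSS subKn// -addnBA ?leq_subr// subKn// bin_sub//.
rewrite [in RHS]rmorphM rmorphXn /= -zw exprMn exprD.
rewrite !rmorphM /= !fmorphV /= !rmorph_nat rmorphXn rmorphN1.
ring.
Qed.

Definition radial beta m n := laguerre beta (maxn m n - minn m n) (minn m n).

(** For m < n the two arguments are exchanged, that is, the angle is negated,
which is why the phase is m - n in both cases. *)
Lemma Zpoly_polar beta m n r x :
  Zpoly beta m n (polar r x) (conjc (polar r x)) =
  (r ^+ (maxn m n - minn m n) * (radial beta m n).[r ^+ 2])%:C
  * cis ((m%:Z - n%:Z)%:~R * x).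
Proof.
rewrite /Zpoly /radial; have [nm|mn] := leqP n m.
  rewrite -{1}(subnK nm) Zge_polar; congr (_ * cis (_ * _)).
  by rewrite subzn.
rewrite -{1}(subnK (ltnW mn)) -{2}[polar r x]conjcK conjc_polar Zge_polar.
congr (_ * cis _); rewrite mulrN -mulNr; congr (_ * _).
by rewrite -[X in X%:~R]opprB subzn ?(ltnW mn)// mulrNz.
Qed.

(** * Finite differences of rising factorials *)

Lemma pochhammerS x n : pochhammer x n.+1 = pochhammer x n * (x + n%:R).
Proof. by rewrite /pochhammer big_ord_recr. Qed.

Lemma pochhammerSl x n : pochhammer x n.+1 = x * pochhammer (x + 1) n.
Proof.
rewrite /pochhammer big_ord_recl addr0; congr (_ * _).
by apply: eq_bigr => i _; rewrite /bump/= natrD addrA.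
Qed.

Lemma pochhammer_gt0 x n : 0 < x -> 0 < pochhammer x n.
Proof. by move=> x0; apply: prodr_gt0 => i _; rewrite ltr_wpDr. Qed.

(** Differencing lowers the degree by one, as for the derivative of x^(j+1). *)
Lemma pochhammer_diff x j :
  pochhammer x j.+1 - pochhammer (x + 1) j.+1 = - j.+1%:R * pochhammer (x + 1) j.
Proof. by rewrite pochhammerSl pochhammerS -natr1; ring. Qed.

(** Pascal's rule: the (n+1)-st difference is the n-th difference of the first
difference. *)
Lemma alternating_binS (u : nat -> R) n :
  \sum_(k < n.+2) 'C(n.+1, k)%:R * (-1) ^+ k * u k =
  \sum_(k < n.+1) 'C(n, k)%:R * (-1) ^+ k * u k
  - \sum_(k < n.+1) 'C(n, k)%:R * (-1) ^+ k * u k.+1.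
Proof.
rewrite big_ord_recl/= bin0.
under eq_bigr => k _ do rewrite /bump/= add1n binS natrD !mulrDl.
rewrite big_split/= addrA; congr (_ + _).
  rewrite [RHS]big_ord_recl/= bin0; congr (_ + _).
  by rewrite big_ord_recr/= bin_small// !mul0r addr0.
by rewrite -sumrN; apply: eq_bigr => k _; rewrite exprS; ring.
Qed.

(** The n-th difference of a polynomial of degree j <= n in k.  Here x is
generalized because each differencing step shifts it by one. *)
Lemma alternating_bin_pochhammer x n j : (j <= n)%N ->
  \sum_(k < n.+1) 'C(n, k)%:R * (-1) ^+ k * pochhammer (x + k%:R) j =
  (j == n)%:R * ((-1) ^+ n * (n`!)%:R).
Proof.
elim: n x j => [|n IH] x [|j] // jn.
- by rewrite big_ord1 /pochhammer big_ord0 bin0 eqxx fact0 !mulr1.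
- rewrite (alternating_binS (fun k => pochhammer (x + k%:R) 0)) /pochhammer.
  under [X in X - _]eq_bigr => k _ do rewrite big_ord0.
  under [X in _ - X]eq_bigr => k _ do rewrite big_ord0.
  by rewrite subrr mul0r.
rewrite (alternating_binS (fun k => pochhammer (x + k%:R) j.+1)) -sumrB.
rewrite (eq_bigr (fun k : 'I_n.+1 => - j.+1%:R *
  ('C(n, k)%:R * (-1) ^+ k * pochhammer (x + 1 + k%:R) j))); last first.
  move=> k _; rewrite -mulrBr -natr1 addrA pochhammer_diff (addrAC x 1).
  by ring.
rewrite -mulr_sumr IH// eqSS; case: eqP => [->|_]; last by rewrite !mul0r mulr0.
by rewrite factS natrM exprS; ring.
Qed.

End Laguerre.

(** * Orthogonality of the Laguerre polynomials *)

Section GammaMoment.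
Context {R : realType}.
Implicit Types (beta c x r : R) (P Q : {poly R}).

Lemma Gamma_pochhammer x n :
  0 < x -> Gamma (x + n%:R) = pochhammer x n * Gamma x.
Proof.
move=> x0; elim: n => [|n IH].
  by rewrite addr0 /pochhammer big_ord0 mul1r.
rewrite -natr1 addrA Gamma_rec; last by rewrite ltr_wpDr.
by rewrite IH pochhammerS mulrCA mulrA.
Qed.

(** For c > -1 this is the integral of P(u) u^c e^(-u) over the half-line,
computed coefficientwise so that orthogonality becomes a finite identity. *)
Definition gamma_moment c P :=
  \sum_(j < size P) P`_j * Gamma (c + j%:R + 1).

Lemma gamma_moment_widen c P n : (size P <= n)%N ->
  gamma_moment c P = \sum_(j < n) P`_j * Gamma (c + j%:R + 1).
Proof.
move=> Pn; rewrite /gamma_moment.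
rewrite (big_ord_widen n (fun j => P`_j * Gamma (c + j%:R + 1)))//.
rewrite big_mkcond; apply: eq_bigr => j _.
by case: ltnP => // /(nth_default 0) ->; rewrite mul0r.
Qed.

Lemma gamma_moment_mulXn c P n : gamma_moment c (P * 'X^n) =
  \sum_(k < size P) P`_k * Gamma (c + k%:R + 1 + n%:R).
Proof.
have sN : (size (P * 'X^n)%R <= n + size P)%N.
  by apply: leq_trans (size_polyMleq _ _) _; rewrite size_polyXn addnS addnC.
rewrite (gamma_moment_widen _ sN) big_split_ord /= big1 ?add0r; last first.
  by move=> k _; rewrite coefMXn ltn_ord mul0r.
apply: eq_bigr => k _; rewrite coefMXn ltnNge leq_addr /= addKn natrD.
by congr (_ * Gamma _); ring.
Qed.

Lemma gamma_moment_mul c P Q : gamma_moment c (P * Q) =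
  \sum_(j < size Q) Q`_j * gamma_moment c (P * 'X^j).
Proof.
(* A common bound on the sizes of P * Q and of all the P * 'X^j. *)
pose N := (size P + size Q)%N.
have sN : (size (P * Q)%R <= N)%N.
  exact: leq_trans (size_polyMleq _ _) (leq_pred _).
rewrite (gamma_moment_widen _ sN).
have -> : P * Q = \sum_(j < size Q) Q`_j *: (P * 'X^j).
  rewrite -{1}[Q]coefK poly_def mulr_sumr.
  by apply: eq_bigr => j _; rewrite scalerAr.
under eq_bigr => i _ do rewrite coef_sum mulr_suml.
rewrite exchange_big; apply: eq_bigr => j _ /=.
rewrite (@gamma_moment_widen _ _ N); last first.
  apply: leq_trans (size_polyMleq _ _) _.
  by rewrite size_polyXn addnS /= leq_add2l ltnW.
by rewrite mulr_sumr; apply: eq_bigr => i _; rewrite coefZ mulrA.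
Qed.

(** The factor Gamma (beta + d + k + 1) of the k-th term cancels the denominator
of the k-th coefficient, leaving the alternating binomial sum of a rising
factorial of length j. *)
Lemma gamma_moment_laguerre_Xn beta d n j : -1 < beta -> (j <= n)%N ->
  gamma_moment (beta + d%:R) (laguerre beta d n * 'X^j) =
  (j == n)%:R * ((-1) ^+ n * Gamma (beta + (d + n)%:R + 1)).
Proof.
move=> hb jn; have b0 : 0 < beta + 1 by rewrite -ltrBlDr sub0r.
have E k : Gamma (beta + d%:R + k%:R + 1 + j%:R) =
   pochhammer (beta + 1 + d%:R + k%:R) j
   * (pochhammer (beta + 1) (d + k) * Gamma (beta + 1)).
  have bdk : 0 < beta + 1 + d%:R + k%:R by rewrite -addrA ltr_wpDr// addr_ge0.
  rewrite -(Gamma_pochhammer _ b0) natrD addrA -(Gamma_pochhammer _ bdk).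
  by congr Gamma; ring.
have sL : (size (laguerre beta d n) <= n.+1)%N by exact: size_poly.
rewrite gamma_moment_mulXn (big_ord_widen n.+1 (fun k =>
  (laguerre beta d n)`_k * Gamma (beta + d%:R + k%:R + 1 + j%:R)))//.
rewrite big_mkcond /=.
rewrite (eq_bigr (fun k : 'I_n.+1 => (n`!)%:R^-1 * Gamma (beta + (d + n)%:R + 1) *
   ('C(n, k)%:R * (-1) ^+ k * pochhammer (beta + 1 + d%:R + k%:R) j))).
  rewrite -mulr_sumr alternating_bin_pochhammer//.
  have F0 : (n`!)%:R != 0 :> R by rewrite pnatr_eq0 -lt0n fact_gt0.
  by field.
move=> k _.
rewrite (_ : (if _ then _ else _) =
  (laguerre beta d n)`_k * Gamma (beta + d%:R + k%:R + 1 + j%:R)); last first.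
  by case: ltnP => // /(nth_default 0) ->; rewrite mul0r.
rewrite E coef_poly ltn_ord.
have -> : Gamma (beta + (d + n)%:R + 1) =
    pochhammer (beta + 1) (d + n) * Gamma (beta + 1).
  by rewrite -(Gamma_pochhammer _ b0); congr Gamma; ring.
have P0 : pochhammer (beta + 1) (d + k) != 0 by rewrite gt_eqF// pochhammer_gt0.
have F0 : (n`!)%:R != 0 :> R by rewrite pnatr_eq0 -lt0n fact_gt0.
by field; rewrite F0 P0.
Qed.

Lemma coef_laguerre_lead beta d n : -1 < beta ->
  (laguerre beta d n)`_n = (-1) ^+ n / (n`!)%:R.
Proof.
move=> hb; have b0 : 0 < beta + 1 by rewrite -ltrBlDr sub0r.
by rewrite coef_poly ltnSn binn divff ?gt_eqF ?pochhammer_gt0// !mul1r mulrC.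
Qed.

(** By symmetry t <= n; expanding the factor of lower degree t in monomials, only
the monomial of degree n can contribute, and it occurs only if t = n. *)
Lemma gamma_moment_laguerre beta d n t : -1 < beta ->
  gamma_moment (beta + d%:R) (laguerre beta d n * laguerre beta d t) =
  (n == t)%:R * (Gamma (beta + (d + n)%:R + 1) / (n`!)%:R).
Proof.
move=> hb; wlog tn : n t / (t <= n)%N => [H|].
  have [/H//|/ltnW/H{}H] := leqP t n.
  by rewrite mulrC H eq_sym; case: eqP => [->|_]; rewrite ?mul0r.
have sL : (size (laguerre beta d t) <= t.+1)%N by exact: size_poly.
rewrite gamma_moment_mul.
rewrite (big_ord_widen t.+1 (fun j => (laguerre beta d t)`_j *
  gamma_moment (beta + d%:R) (laguerre beta d n * 'X^j)))//.
rewrite big_mkcond /= (eq_bigr (fun j : 'I_t.+1 => (laguerre beta d t)`_j *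
  ((j == n :> nat)%:R * ((-1) ^+ n * Gamma (beta + (d + n)%:R + 1))))); last first.
  move=> j _; rewrite -gamma_moment_laguerre_Xn//; last first.
    by apply: leq_trans tn; rewrite -ltnS.
  by case: ltnP => // /(nth_default 0) ->; rewrite mul0r.
rewrite big_ord_recr /= big1 ?add0r; last first.
  by move=> j _; rewrite ltn_eqF ?mul0r ?mulr0//; apply: leq_trans tn.
rewrite eq_sym; case: eqP => [<-|_]; last by rewrite !mul0r mulr0.
rewrite coef_laguerre_lead// !mul1r.
transitivity (((-1) ^+ n * (-1) ^+ n) *
  (Gamma (beta + (d + n)%:R + 1) / (n`!)%:R)); first by ring.
by rewrite -exprD addnn -signr_odd odd_double mul1r.
Qed.

End GammaMoment.

(** * Integrals of products of functions of separate variables *)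

Section ProdSep.
Context d1 d2 (T1 : measurableType d1) (T2 : measurableType d2) (R : realType).
Variables (m1 : {sigma_finite_measure set T1 -> \bar R})
  (m2 : {sigma_finite_measure set T2 -> \bar R}).

Let measurable_tensor (f : T1 -> R) (g : T2 -> R) :
  measurable_fun setT f -> measurable_fun setT g ->
  measurable_fun setT (fun z : T1 * T2 => (f z.1 * g z.2)%:E).
Proof.
move=> mf mg; apply/measurable_EFinP; apply: measurable_funM.
  exact: (measurableT_comp mf measurable_fst).
exact: (measurableT_comp mg measurable_snd).
Qed.

Let integrable_tensorT (f : T1 -> R) (g : T2 -> R) :
  m1.-integrable setT (EFin \o f) -> m2.-integrable setT (EFin \o g) ->
  (m1 \x m2)%E.-integrable setT (fun z : T1 * T2 => (f z.1 * g z.2)%:E).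
Proof.
move=> If Ig.
have mf : measurable_fun setT f by apply/measurable_EFinP; case/integrableP : If.
have mg : measurable_fun setT g by apply/measurable_EFinP; case/integrableP : Ig.
apply/integrable12ltyP; first exact: measurable_tensor.
under eq_integral => x _.
  rewrite /=.
  under eq_integral => y _ do rewrite normrM EFinM.
  rewrite ge0_integralZl//; last first.
    by apply/measurable_EFinP; exact: measurableT_comp.
  over.
rewrite /= ge0_integralZr//; last 2 first.
- by apply/measurable_EFinP; exact: measurableT_comp.
- exact: integral_ge0.
case/integrableP : If => _ /=; case/integrableP : Ig => _ /=.
move=> lg lf; rewrite lte_mul_pinfty//.
- exact: integral_ge0.
- by rewrite ge0_fin_numE//; exact: integral_ge0.
Qed.

Let Rintegral_tensorT (f : T1 -> R) (g : T2 -> R) :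
  m1.-integrable setT (EFin \o f) -> m2.-integrable setT (EFin \o g) ->
  (\int[(m1 \x m2)%E]_z (f z.1 * g z.2) = (\int[m1]_x f x) * (\int[m2]_y g y))%R.
Proof.
move=> If Ig.
rewrite /Rintegral -(integral12_prod_meas1 (integrable_tensorT If Ig)) /fubini_F/=.
under eq_integral => x _.
  under eq_integral => y _ do rewrite EFinM.
  rewrite integralZl//.
  over.
have fg : (\int[m2]_y (g y)%:E)%E \is a fin_num by exact: integrable_fin_num Ig.
have ff : (\int[m1]_y (f y)%:E)%E \is a fin_num by exact: integrable_fin_num If.
by rewrite /= -(fineK fg) integralZr// -[in LHS](fineK ff) -EFinM.
Qed.

Variables (A : set T1) (B : set T2) (f : T1 -> R) (g : T2 -> R).
Hypotheses (mA : measurable A) (mB : measurable B).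
Hypotheses (If : m1.-integrable A (EFin \o f))
  (Ig : m2.-integrable B (EFin \o g)).

Let restrict_tensor (z : T1 * T2) :
  ((fun z => f z.1 * g z.2) \_ (A `*` B)) z = (f \_ A) z.1 * (g \_ B) z.2.
Proof.
rewrite !patchE in_setX; case: (z.1 \in A); case: (z.2 \in B) => //=;
  by rewrite ?mul0r ?mulr0.
Qed.

Lemma integrable_tensor :
  (m1 \x m2)%E.-integrable (A `*` B) (fun z : T1 * T2 => (f z.1 * g z.2)%:E).
Proof.
apply/integrable_mkcond; first exact: measurableX.
rewrite (_ : _ \_ _ = fun z => ((f \_ A) z.1 * (g \_ B) z.2)%:E); last first.
  apply/funext => z; rewrite -restrict_tensor.
  by rewrite -[LHS]/((EFin \o _) \_ _ z) restrict_EFin.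
by apply: integrable_tensorT; rewrite -restrict_EFin;
  exact: (integrable_mkcond _ _).1.
Qed.

Lemma Rintegral_tensor :
  (\int[(m1 \x m2)%E]_(z in A `*` B) (f z.1 * g z.2) =
   (\int[m1]_(x in A) f x) * (\int[m2]_(y in B) g y))%R.
Proof.
rewrite Rintegral_mkcond [X in _ = X * _]Rintegral_mkcond.
rewrite [X in _ = _ * X]Rintegral_mkcond.
rewrite -Rintegral_tensorT; last 2 first.
- by rewrite -restrict_EFin; exact: (integrable_mkcond _ _).1.
- by rewrite -restrict_EFin; exact: (integrable_mkcond _ _).1.
by apply: eq_Rintegral => z _; exact: restrict_tensor.
Qed.

End ProdSep.

(** * Angular integrals *)

Section Angular.
Context {R : realType}.
Local Notation mu := (@lebesgue_measure R).

Lemma cos_sin_int_period (k : int) :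
  cos (k%:~R * (2 * pi)) = 1 :> R /\ sin (k%:~R * (2 * pi)) = 0 :> R.
Proof.
have H (n : nat) :
    cos (n%:R * (2 * pi)) = 1 :> R /\ sin (n%:R * (2 * pi)) = 0 :> R.
  elim: n => [|n [IHc IHs]]; first by rewrite mul0r cos0 sin0.
  rewrite -natr1 mulrDl mul1r cosD sinD IHc IHs mulr_natl cos2pi sin2pi.
  by split; ring.
case: k => n; first exact: H.
by rewrite NegzE mulrNz mulNr cosN sinN; have [-> ->] := H n.+1; rewrite oppr0.
Qed.

Lemma continuous_cosM (c : R) : continuous (fun t => cos (c * t)).
Proof.
move=> t; apply: continuous_comp; first exact: mulrl_continuous.
exact: continuous_cos.
Qed.

Lemma continuous_sinM (c : R) : continuous (fun t => sin (c * t)).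
Proof.
move=> t; apply: continuous_comp; first exact: mulrl_continuous.
exact: continuous_sin.
Qed.

Lemma integrable_period (h : R -> R) : continuous h ->
  mu.-integrable `[0, 2 * pi[ (EFin \o h).
Proof.
move=> ch; apply: (@integrableS _ _ _ mu (`[0, 2 * pi]%classic : set R)) => //.
  by move=> x /=; rewrite !in_itv/= => /andP[-> /ltW].
apply: continuous_compact_integrable; first exact: segment_compact.
exact: continuous_subspaceT.
Qed.

Lemma Rintegral_period_derivative (F h : R -> R) : continuous h ->
  (forall x : R, is_derive x 1 F (h x)) ->
  \int[mu]_(x in `[0, 2 * pi[) h x = F (2 * pi) - F 0.
Proof.
move=> ch dF; have cF x : {for x, continuous F}.
  by have [/derivable1_diffP/differentiable_continuous] := dF x.
rewrite Rintegral_itv_bndo_bndc; last exact: integrable_period.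
rewrite /Rintegral (@continuous_FTC2 _ _ F) //.
- by rewrite mulr_gt0// pi_gt0.
- exact: continuous_subspaceT.
- split; first by move=> x _; have [] := dF x.
  + by apply: cvg_at_right_filter; exact: cF.
  + by apply: cvg_at_left_filter; exact: cF.
- by move=> x _; rewrite derive1E; have [_ ->] := dF x.
Qed.

Lemma is_derive_sinM (c x : R) :
  is_derive x 1 (fun t : R => sin (c * t)) (c * cos (c * x)).
Proof. by apply: is_derive_eq; rewrite /GRing.scale/= mulr1 mulrC. Qed.

Lemma is_derive_cosM (c x : R) :
  is_derive x 1 (fun t : R => cos (c * t)) (- (c * sin (c * x))).
Proof. by apply: is_derive_eq; rewrite /GRing.scale/= mulr1 mulrC mulrN. Qed.

Lemma Rintegral_cos_int (k : int) :
  \int[mu]_(x in `[0, 2 * pi[) cos (k%:~R * x) = 2 * pi * (k == 0)%:R.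
Proof.
have [->|k0] := eqVneq k 0.
  have d (x : R) : is_derive x 1 id (cos (0%:~R * x)).
    by rewrite mul0r cos0; exact: is_derive_id.
  by rewrite mulr1 (Rintegral_period_derivative (@continuous_cosM _) d) subr0.
have kR : k%:~R != 0 :> R by rewrite intr_eq0.
have d (x : R) :
    is_derive x 1 (fun x : R => k%:~R^-1 * sin (k%:~R * x)) (cos (k%:~R * x)).
  have D := is_derive_sinM k%:~R x.
  by apply: is_derive_eq; rewrite [LHS]mulrA mulVf// mul1r.
rewrite (Rintegral_period_derivative (@continuous_cosM _) d).
by have [_ ->] := cos_sin_int_period k; rewrite !mulr0 sin0 !mulr0 subr0.
Qed.

Lemma Rintegral_sin_int (k : int) :
  \int[mu]_(x in `[0, 2 * pi[) sin (k%:~R * x) = 0.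
Proof.
have [->|k0] := eqVneq k 0.
  rewrite (@eq_Rintegral _ _ _ _ _ (fun=> 0)); last first.
    by move=> x _; rewrite mul0r sin0.
  by rewrite Rintegral_cst// mul0r.
have kR : k%:~R != 0 :> R by rewrite intr_eq0.
have d (x : R) : is_derive x 1 (fun x : R => - (k%:~R^-1 * cos (k%:~R * x)))
    (sin (k%:~R * x)).
  have D := is_derive_cosM k%:~R x.
  apply: is_derive_eq.
  by rewrite [X in - X]mulrN opprK [LHS]mulrA mulVf// mul1r.
rewrite (Rintegral_period_derivative (@continuous_sinM _) d).
by have [-> _] := cos_sin_int_period k; rewrite mulr0 cos0 subrr.
Qed.

End Angular.

(** * Radial integrals *)

Section RadialIntegral.
Context {R : realType}.
Local Notation mu := (@lebesgue_measure R).

Lemma integral_radial_sum n (a b : nat -> R) : (forall j, 0 < b j) ->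
  mu.-integrable (halfline R)
    (EFin \o (fun r => \sum_(j < n) a j * radial_density (b j) r)) /\
  \int[mu]_(r in halfline R) (\sum_(j < n) a j * radial_density (b j) r) =
  \sum_(j < n) a j * (Gamma (b j) / 2).
Proof.
move=> b0; elim: n => [|n [IHi IHv]].
  rewrite big_ord0.
  under [X in mu.-integrable _ (_ \o X)]eq_fun do rewrite big_ord0.
  split; first exact: integrable0.
  under eq_Rintegral do rewrite big_ord0.
  by rewrite Rintegral_cst// mul0r.
have I : mu.-integrable (halfline R)
    (EFin \o (fun r => a n * radial_density (b n) r)).
  apply: (@integrableZl _ _ _ mu _ _ (a n) (EFin \o radial_density (b n))) => //.
  exact: integrable_radial_density.
under [X in mu.-integrable _ (_ \o X)]eq_fun do rewrite big_ord_recr /=.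
split; first exact: (integrableD _ IHi I).
under eq_Rintegral do rewrite big_ord_recr /=.
rewrite RintegralD// IHv big_ord_recr /= RintegralZl//; last first.
  exact: integrable_radial_density.
by congr (_ + _ * _); rewrite /Rintegral integral_radial_density.
Qed.

Lemma integral_radial_poly c (P : {poly R}) : -1 < c ->
  mu.-integrable (halfline R)
    (EFin \o (fun r => P.[r ^+ 2] * ((r ^+ 2) `^ c * expR (- r ^+ 2) * r))) /\
  \int[mu]_(r in halfline R)
    (P.[r ^+ 2] * ((r ^+ 2) `^ c * expR (- r ^+ 2) * r)) =
  gamma_moment c P / 2.
Proof.
move=> hc.
have b0 j : 0 < c + j%:R + 1 by rewrite addrAC ltr_wpDr// -ltrBlDr sub0r.
have [I V] := @integral_radial_sum (size P) (fun j => P`_j)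
  (fun j => c + j%:R + 1) b0.
have E : {in halfline R,
    (fun r => \sum_(j < size P) P`_j * radial_density (c + j%:R + 1) r) =1
    (fun r => P.[r ^+ 2] * ((r ^+ 2) `^ c * expR (- r ^+ 2) * r))}.
  move=> r; rewrite inE/= in_itv/= andbT => r0.
  rewrite horner_coef mulr_suml; apply: eq_bigr => j _.
  rewrite /radial_density addrK powRD; last by rewrite expf_neq0 ?implybT// gt_eqF.
  by rewrite powR_mulrn ?exprn_ge0 ?ltW//; ring.
split.
  by apply: eq_integrable I => // r rh; rewrite /= E.
have -> : \int[mu]_(r in halfline R)
      (P.[r ^+ 2] * ((r ^+ 2) `^ c * expR (- r ^+ 2) * r)) =
    \int[mu]_(r in halfline R)
      (\sum_(j < size P) P`_j * radial_density (c + j%:R + 1) r).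
  by apply: eq_Rintegral => r rh; rewrite E.
rewrite V /gamma_moment mulr_suml.
by apply: eq_bigr => j _; rewrite mulrA.
Qed.

End RadialIntegral.

(** * Separation of the integrand *)

Section Assembly.
Context {R : realType}.
Local Notation mu := (@lebesgue_measure R).

Definition radial_part beta m n s t (r : R) : R :=
  r ^+ (maxn m n - minn m n) * (radial beta m n).[r ^+ 2]
  * (r ^+ (maxn s t - minn s t) * (radial beta s t).[r ^+ 2])
  * ((r ^+ 2) `^ beta * expR (- r ^+ 2)) * r.

Lemma Zintegrand_polar beta m n s t (r x : R) :
  Zintegrand beta m n s t (polar r x) * r%:C =
  (radial_part beta m n s t r)%:C
  * cis (((m%:Z - n%:Z) - (s%:Z - t%:Z))%:~R * x).
Proof.
rewrite /Zintegrand !Zpoly_polar Zweight_polar conjc_mul_cis.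
have -> : ((m%:Z - n%:Z) - (s%:Z - t%:Z))%:~R * x =
    (m%:Z - n%:Z)%:~R * x + - ((s%:Z - t%:Z)%:~R * x) :> R.
  by rewrite rmorphB /= mulrBl.
by rewrite cisD /radial_part !rmorphM /=; ring.
Qed.

(** The power of r coming from the two factors may be odd, so it is absorbed into
the real exponent of r^2. *)
Lemma radial_partE beta m n s t (r : R) : 0 < r ->
  radial_part beta m n s t r =
  (radial beta m n * radial beta s t).[r ^+ 2]
  * ((r ^+ 2) `^ (beta + ((maxn m n - minn m n) + (maxn s t - minn s t))%:R / 2)
     * expR (- r ^+ 2) * r).
Proof.
move=> r0.
rewrite powRD; last by rewrite expf_neq0 ?implybT// gt_eqF.
have -> k : (r ^+ 2) `^ (k%:R / 2) = r ^+ k.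
  rewrite -powR_mulrn ?ltW// -powRrM mulrCA divff ?pnatr_eq0// mulr1.
  by rewrite powR_mulrn// ltW.
by rewrite hornerM exprD /radial_part; ring.
Qed.

Lemma radial_part_integral beta m n s t : -1 < beta ->
  mu.-integrable (halfline R) (EFin \o radial_part beta m n s t) /\
  \int[mu]_(r in halfline R) radial_part beta m n s t r =
  gamma_moment (beta + ((maxn m n - minn m n) + (maxn s t - minn s t))%:R / 2)
    (radial beta m n * radial beta s t) / 2.
Proof.
move=> hb.
set c := beta + _.
have hc : -1 < c by rewrite ltr_wpDr// divr_ge0.
have [I V] := integral_radial_poly (radial beta m n * radial beta s t) hc.
split.
  apply: eq_integrable I => // r; rewrite inE/= in_itv/= andbT => r0.
  by rewrite radial_partE.
rewrite -V; apply: eq_Rintegral => r; rewrite inE/= in_itv/= andbT => r0.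
by rewrite radial_partE.
Qed.

(** When the phases agree, the two exponents d coincide and the exponent of
[radial_partE] is beta + d, the weight of both Laguerre polynomials. *)
Lemma radial_part_orthogonal beta m n s t : -1 < beta ->
  (m%:Z - n%:Z = s%:Z - t%:Z)%R ->
  \int[mu]_(r in halfline R) radial_part beta m n s t r =
  Gamma (beta + (maxn m n)%:R + 1) / ((minn m n)`!)%:R
  * (m == s)%:R * (n == t)%:R / 2.
Proof.
move=> hb /eqP; rewrite subr_eq addrAC eq_sym subr_eq -!PoszD eqz_nat => /eqP mt.
have dE : (maxn s t - minn s t = maxn m n - minn m n)%N by lia.
have mE : (m == s) && (n == t) = (minn m n == minn s t) by lia.
rewrite (radial_part_integral _ _ _ _ hb).2 dE /radial dE addnn -mul2n natrM.
rewrite mulrAC divff ?pnatr_eq0// mul1r.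
rewrite gamma_moment_laguerre// subnK; last by lia.
by rewrite -mE; case: (m == s); case: (n == t);
  rewrite /= ?(mulr0, mul0r, mulr1, mul1r).
Qed.

End Assembly.

Lemma integral_polar_tensor (R : realType) (g h : R -> R) :
  (@lebesgue_measure R).-integrable (halfline R) (EFin \o g) ->
  (@lebesgue_measure R).-integrable `[0, 2 * pi[ (EFin \o h) ->
  (drdtheta R).-integrable (@polar_domain R) (fun p => (g p.1 * h p.2)%:E) /\
  \int[drdtheta R]_(p in @polar_domain R) (g p.1 * h p.2) =
  (\int[@lebesgue_measure R]_(r in halfline R) g r) *
  (\int[@lebesgue_measure R]_(x in `[0, 2 * pi[) h x).
Proof.
move=> Ig Ih; split.
- by apply: integrable_tensor.
- by apply: Rintegral_tensor.
Qed.

(** * The orthogonality relation *)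

Theorem theorem3p1 (R : realType) (beta : R) (hbeta : -1 < beta)
    (m n s t : nat) :
  let f := fun p : R * R =>
    Zintegrand beta m n s t (polar p.1 p.2) * (p.1)%:C in
  cintegrable (drdtheta R) (@polar_domain R) f /\
  cintegral (drdtheta R) (@polar_domain R) f =
    (pi * (Gamma (beta + (maxn m n)%:R + 1) / ((minn m n)`!)%:R)
     * (m == s)%:R * (n == t)%:R)%:C.
Proof.
move=> f; pose k : int := ((m%:Z - n%:Z) - (s%:Z - t%:Z))%R.
have fE p : f p = (radial_part beta m n s t p.1 * cos (k%:~R * p.2)) +i*
   (radial_part beta m n s t p.1 * sin (k%:~R * p.2)).
  by rewrite /f Zintegrand_polar mul_real_cis.
have [I _] := @radial_part_integral R beta m n s t hbeta.
have Ic := integrable_period (@continuous_cosM R k%:~R).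
have Is := integrable_period (@continuous_sinM R k%:~R).
have [Jc Vc] := integral_polar_tensor I Ic.
have [Js Vs] := integral_polar_tensor I Is.
split.
  split.
    by under eq_fun => p do rewrite fE /=.
  by under eq_fun => p do rewrite fE /=.
rewrite /cintegral.
under eq_Rintegral do rewrite fE /=.
under [X in _ +i* X]eq_Rintegral do rewrite fE /=.
rewrite Vc Vs.
rewrite Rintegral_cos_int Rintegral_sin_int mulr0 complexr0; congr (_%:C).
have [k0|k0] := eqVneq k 0.
  rewrite radial_part_orthogonal//; last by apply/eqP; rewrite -subr_eq0; apply/eqP.
  by rewrite mulr1; field; rewrite pnatr_eq0 -lt0n fact_gt0.
rewrite !mulr0.
have [ms|_] := eqVneq m s; last by rewrite mulr0 mul0r.
have [nt|_] := eqVneq n t; last by rewrite mulr0.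
by move: k0; rewrite /k ms nt subrr eqxx.
Qed.
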